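(* Consider the fourth order ODE $$u''''=F(u',u'',u'''),\qquad F(p,q,r)=-3\frac{q^3}{p^2}+4\frac{qr}{p},$$ on the region $p=u'\neq0$. Its Wünschmann invariants $W_1$ and $W_0$ satisfy $$W_1=0\qquad\text{and}\qquad W_0=-\frac{36}{100}S(u)^2,$$ where $S(u)=\frac{r}{p}-\frac32\left(\frac{q}{p}\right)^2$. The projective tangent bundle $P(T\mathcal{M})$ of the solution space $\mathcal{M}$ of the equation is equipped with a field of curves (the canonical field of curves, given at each $s\in\mathcal{M}$ by the lines $\pi_*(\mathrm{span}(\partial_r))\subset T_s\mathcal{M}$) that are (a) projectively equivalent to the curve $t\mapsto(e^{-t},t,-e^t)$ at points of $\mathcal{M}$ corresponding to solutions such that $S(u)<0$; (b) projectively equivalent to the curve $t\mapsto(t-\sin t,\cos t,t+\sin t)$ at points of $\mathcal{M}$ corresponding to solutions such that $S(u)>0$; (c) projectively equivalent to the rational normal curve at points of $\mathcal{M}$ corresponding to solutions such that $S(u)=0$.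
   Context: Let $J^3(\mathbb{R},\mathbb{R})$ be the space of 3-jets of functions $\mathbb{R}\to\mathbb{R}$ with standard coordinates $(t,u,p,q,r)$, where $t$ is the independent variable, $u$ the dependent variable, $p=u'$, $q=u''$, $r=u'''$; we restrict to $p\neq0$. The total derivative is $\frac{d}{dt}=X_F=\partial_t+p\,\partial_u+q\,\partial_p+r\,\partial_q+F\,\partial_r$. Subscripts on $F$ denote partial derivatives. The (generalized) Wünschmann invariants of $u''''=F$ are $$W_1=\frac{9}{4}F_r\frac{d}{dt}F_r-\frac{3}{2}\frac{d^2}{dt^2}F_r+3\frac{d}{dt}F_q-\frac{3}{8}F_r^3-\frac{3}{2}F_qF_r-3F_p,$$ $$\begin{aligned}W_0=&\frac{11}{1600}F_r^4-\frac{9}{50}F_r^2\frac{d}{dt}F_r-\frac{1}{200}F_r^2F_q+\frac{21}{100}\left(\frac{d}{dt}F_r\right)^2+\frac{1}{50}\left(\frac{d}{dt}F_r\right)F_q-\frac{9}{100}F_q^2\\&+\frac{7}{20}F_r\frac{d^2}{dt^2}F_r-\frac{1}{5}\frac{d^3}{dt^3}F_r+\frac{3}{10}\frac{d^2}{dt^2}F_q-\frac{1}{4}F_r\frac{d}{dt}F_q.\end{aligned}$$ The solution space is the (4-dimensional) quotient $\mathcal{M}=J^3(\mathbb{R},\mathbb{R})/X_F$, i.e. the space of integral curves of $X_F$, with quotient map $\pi\colon J^3(\mathbb{R},\mathbb{R})\to\mathcal{M}$. For $s\in\mathcal{M}$, pushing forward the line $\mathrm{span}(\partial_r)$ by $\pi_*$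 from each point of the integral curve $\pi^{-1}(s)$ gives a one-parameter family of lines in $T_s\mathcal{M}$, i.e. a curve in $P(T_s\mathcal{M})\cong\mathbb{RP}^3$; these form the canonical field of curves. $S(u)$, the Schwarzian derivative, is constant along each solution, so its sign is well defined at points of $\mathcal{M}$. Curves are considered unparametrized; curves written with three components are given in an affine chart of $\mathbb{RP}^3$, $(x,y,z)\leftrightarrow(1:x:y:z)$. The rational normal curve is $t\mapsto(1:t:t^2:t^3)$. ''Projectively equivalent'' means that a projective isomorphism $P(T_s\mathcal{M})\to\mathbb{RP}^3$ carries the curve to the given model curve, with the parameter of the latter restricted to an interval corresponding to the interval of definition of the solution. *)

(* Defs.v *)
From Stdlib Require Import Reals.
From Coquelicot Require Import Coquelicot.
Open Scope R_scope.

(** Jets [(t, u, p, q, r)].  The jet space of the paper is the open subset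
    [jp x <> 0] of [J3]; this restriction is imposed on integral curves below. *)
Definition J3 : Type := (R * R * R * R * R)%type.
Definition R3 : Type := (R * R * R)%type.
Definition R4 : Type := (R * R * R * R)%type.

Definition jt (x : J3) : R := let '(t, u, p, q, r) := x in t.
Definition jp (x : J3) : R := let '(t, u, p, q, r) := x in p.
Definition jq (x : J3) : R := let '(t, u, p, q, r) := x in q.
Definition jr (x : J3) : R := let '(t, u, p, q, r) := x in r.

Definition jet_at (t : R) (y : R4) : J3 :=
  let '(u, p, q, r) := y in (t, u, p, q, r).

Definition pd_t (G : J3 -> R) (x : J3) : R :=
  let '(t, u, p, q, r) := x in Derive (fun h => G (h, u, p, q, r)) t.
Definition pd_u (G : J3 -> R) (x : J3) : R :=
  let '(t, u, p, q, r) := x in Derive (fun h => G (t, h, p, q, r)) u.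
Definition pd_p (G : J3 -> R) (x : J3) : R :=
  let '(t, u, p, q, r) := x in Derive (fun h => G (t, u, h, q, r)) p.
Definition pd_q (G : J3 -> R) (x : J3) : R :=
  let '(t, u, p, q, r) := x in Derive (fun h => G (t, u, p, h, r)) q.
Definition pd_r (G : J3 -> R) (x : J3) : R :=
  let '(t, u, p, q, r) := x in Derive (fun h => G (t, u, p, q, h)) r.

(** [X_F], as a vector field and as a derivation. *)
Definition XF (F : J3 -> R) (x : J3) : J3 := (1, jp x, jq x, jr x, F x).

Definition total (F G : J3 -> R) (x : J3) : R :=
  pd_t G x + jp x * pd_u G x + jq x * pd_p G x + jr x * pd_q G x
  + F x * pd_r G x.

Definition W1 (F : J3 -> R) (x : J3) : R :=
  let d := total F in
  let Fr := pd_r F in let Fq := pd_q F in let Fp := pd_p F in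
  9/4 * Fr x * d Fr x - 3/2 * d (d Fr) x + 3 * d Fq x
  - 3/8 * Fr x ^ 3 - 3/2 * Fq x * Fr x - 3 * Fp x.

Definition W0 (F : J3 -> R) (x : J3) : R :=
  let d := total F in
  let Fr := pd_r F in let Fq := pd_q F in
  11/1600 * Fr x ^ 4 - 9/50 * Fr x ^ 2 * d Fr x - 1/200 * Fr x ^ 2 * Fq x
  + 21/100 * d Fr x ^ 2 + 1/50 * d Fr x * Fq x - 9/100 * Fq x ^ 2
  + 7/20 * Fr x * d (d Fr) x - 1/5 * d (d (d Fr)) x
  + 3/10 * d (d Fq) x - 1/4 * Fr x * d Fq x.

Definition is_integral_curve (F : J3 -> R) (a b : R) (gamma : R -> J3) : Prop :=
  forall h, a < h < b ->
    jp (gamma h) <> 0 /\ is_derive gamma h (XF F (gamma h)).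

(** The quotient map: [pi F x] is the (maximal) integral curve through [x],
    as a subset of the jet space.  Two jets lie on the same maximal integral
    curve iff some integral curve on a bounded open interval joins them. *)
Definition pi (F : J3 -> R) (x : J3) : J3 -> Prop :=
  fun y => exists (a b : R) (gamma : R -> J3) (h k : R),
    is_integral_curve F a b gamma /\ a < h < b /\ a < k < b /\
    gamma h = x /\ gamma k = y.

(** [s] is a point of the solution space [M]. *)
Definition solution_space (F : J3 -> R) (s : J3 -> Prop) : Prop :=
  exists x, jp x <> 0 /\ s = pi F x.

Definition interval_of_definition (s : J3 -> Prop) (t : R) : Prop :=
  exists y, s (jet_at t y).

(** Since [dt (X_F) = 1], an integral curve meets each slice [t = t0] at most
    once, and [M] is covered by the charts
      [{ s | interval_of_definition s t0 } -> R4],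
      [s |-> the y with s (jet_at t0 y)]
    (initial data at time [t0]), whose transition maps are the flow maps of
    [X_F].  For [t0] in the interval of [s], the chart at [t0] identifies
    [T_s M] with [R4].  [is_pushforward F t0 x L] says that [L] is the
    differential of [pi] at [x], written in the chart at [t0]. *)
Definition is_pushforward (F : J3 -> R) (t0 : R) (x : J3) (L : J3 -> R4) : Prop :=
  exists Y : J3 -> R4,
    locally x (fun x' => pi F x' (jet_at t0 (Y x'))) /\
    filterdiff Y (locally x) L.

Definition partial_r : J3 := (0, 0, 0, 0, 1).

(** Equality in [RP^3] of the points with homogeneous coordinates [v], [w]. *)
Definition same_point (v w : R4) : Prop :=
  v <> zero /\ w <> zero /\ exists k : R, k <> 0 /\ v = scal k w.

(** The linear isomorphisms; they induce the projective isomorphisms of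
    [RP^3]. *)
Definition linear_iso (A : R4 -> R4) : Prop :=
  is_linear A /\
  exists B : R4 -> R4, (forall v, B (A v) = v) /\ (forall v, A (B v) = v).

Definition reparametrization (D : R -> Prop) (phi : R -> R) : Prop :=
  forall t, D t -> (forall n, ex_derive_n phi n t) /\ Derive phi t <> 0.

(** At the point [s] of [M], the canonical curve
    [t |-> pi_* (span partial_r)] is projectively equivalent to the curve [c]
    in [RP^3], restricted to the interval [phi (interval_of_definition s)].
    The isomorphism [A] depends on the chart used to represent [T_s M]. *)
Definition canonical_curve_equivalent (F : J3 -> R) (s : J3 -> Prop)
    (c : R -> R4) : Prop :=
  forall t0, interval_of_definition s t0 ->
  exists (A : R4 -> R4) (phi : R -> R),
    linear_iso A /\ reparametrization (interval_of_definition s) phi /\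
    forall t y, s (jet_at t y) ->
      exists L : J3 -> R4,
        is_pushforward F t0 (jet_at t y) L /\
        same_point (A (L partial_r)) (c (phi t)).

Definition affine_chart (v : R3) : R4 :=
  let '(x, y, z) := v in (1, x, y, z).

Definition rational_normal_curve (t : R) : R4 := (1, t, t ^ 2, t ^ 3).

Definition F_eq (x : J3) : R :=
  let '(t, u, p, q, r) := x in - 3 * (q ^ 3 / p ^ 2) + 4 * (q * r / p).

Definition Schwarzian (x : J3) : R :=
  let '(t, u, p, q, r) := x in r / p - 3/2 * (q / p) ^ 2.

(* Main.v *)
Require Import Defs.
From Stdlib Require Import Reals Lra Psatz ClassicalEpsilon List.
From Coquelicot Require Import Coquelicot.
Import ListNotations.
Open Scope R_scope.

(** The equation says exactly that the Schwarzian [S(u)] is constant.  Put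
    [k = S(u)/2] and let [v = |p|^(-1/2)]; then [v'' + k v = 0], which
    integrates the flow of [X_F] in closed form and shows that a solution
    exists as long as [v] does not vanish.  Varying [r] at time [t] varies [S]
    to first order while fixing the 2-jet, and the induced variation of the
    solution is [p f], where [f''' + 4 k f'] is constant and [f] has zero
    2-jet at [t].  Up to a linear isomorphism depending only on the jet at
    [t0], the canonical curve is therefore the curve of 3-jets of [f] at [t0],
    as a function of [t0 - t], and [f] is [x - sin x], [sinh x - x] or [x^3]
    up to scaling.  The fundamental solutions of [v'' + k v = 0] are written as
    power series in [k tau^2], so that they are smooth in [k] also at [k = 0]. *)

(** * The invariants *)

(** Allows a closed form valid only on [jp x <> 0] to be substituted under an iterated total
    derivative. Four of the partial derivatives keep [p] fixed; the one in [p] needs equality on a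
    neighbourhood, which openness of the region supplies. *)
Lemma total_ext (F G H : J3 -> R) :
  (forall x, jp x <> 0 -> G x = H x) ->
  forall x, jp x <> 0 -> total F G x = total F H x.
Proof.
  intros E [[[[t u] p] q] r] Hp; simpl in Hp.
  unfold total, pd_t, pd_u, pd_p, pd_q, pd_r.
  rewrite (Derive_ext (fun h => G (h, u, p, q, r)) (fun h => H (h, u, p, q, r)))
    by (intros; now apply E).
  rewrite (Derive_ext (fun h => G (t, h, p, q, r)) (fun h => H (t, h, p, q, r)))
    by (intros; now apply E).
  rewrite (Derive_ext (fun h => G (t, u, p, h, r)) (fun h => H (t, u, p, h, r)))
    by (intros; now apply E).
  rewrite (Derive_ext (fun h => G (t, u, p, q, h)) (fun h => H (t, u, p, q, h)))
    by (intros; now apply E).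
  rewrite (Derive_ext_loc (fun h => G (t, u, h, q, r)) (fun h => H (t, u, h, q, r)));
    [reflexivity|].
  generalize (open_neq 0 p Hp); apply filter_imp.
  intros h Hh; now apply E.
Qed.

Ltac derive_field :=
  repeat match goal with |- context [Derive ?f ?x] =>
    let D := fresh "D" in
    evar (D : R); let D' := eval unfold D in D in
    replace (Derive f x) with D'; subst D;
    [|symmetry; apply is_derive_unique; auto_derive;
      [repeat split; auto using Rmult_integral_contrapositive_currified, R1_neq_R0
      |reflexivity]]
  end; field; auto.

Lemma pd_r_F_eq x : jp x <> 0 -> pd_r F_eq x = 4 * (jq x / jp x).
Proof.
  destruct x as [[[[t u] p] q] r]; intros Hp; simpl in *. derive_field.
Qed.

Lemma pd_q_F_eq x : jp x <> 0 ->
  pd_q F_eq x = -9 * (jq x ^ 2 / jp x ^ 2) + 4 * (jr x / jp x).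
Proof.
  destruct x as [[[[t u] p] q] r]; intros Hp; simpl in *. derive_field.
Qed.

Lemma pd_p_F_eq x : jp x <> 0 ->
  pd_p F_eq x = 6 * (jq x ^ 3 / jp x ^ 3) - 4 * (jq x * jr x / jp x ^ 2).
Proof.
  destruct x as [[[[t u] p] q] r]; intros Hp; simpl in *. derive_field.
Qed.

Ltac total_field :=
  let x := fresh in intros x; destruct x as [[[[t u] p] q] r]; intros Hp; simpl in *;
  unfold total, pd_t, pd_u, pd_p, pd_q, pd_r, F_eq; simpl; derive_field.

Lemma wuenschmann_F_eq x : jp x <> 0 ->
  W1 F_eq x = 0 /\ W0 F_eq x = - (36/100) * Schwarzian x ^ 2.
Proof.
  intros Hx.
  (* Each total derivative is put in simplified rational form before the next is taken, so that
     every step differentiates an explicit function. *)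
  assert (R1 : forall x, jp x <> 0 -> total F_eq (pd_r F_eq) x
     = 4 * (jr x / jp x - jq x ^ 2 / jp x ^ 2)).
  { intros y Hy. rewrite (total_ext _ _ _ pd_r_F_eq y Hy).
    revert y Hy; total_field. }
  assert (R2 : forall x, jp x <> 0 -> total F_eq (total F_eq (pd_r F_eq)) x
     = 4 * (jq x * jr x / jp x ^ 2 - jq x ^ 3 / jp x ^ 3)).
  { intros y Hy. rewrite (total_ext _ _ _ R1 y Hy).
    revert y Hy; total_field. }
  assert (R3 : forall x, jp x <> 0 -> total F_eq (total F_eq (total F_eq (pd_r F_eq))) x
     = 4 * (jr x ^ 2 / jp x ^ 2 - jq x ^ 2 * jr x / jp x ^ 3)).
  { intros y Hy. rewrite (total_ext _ _ _ R2 y Hy).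
    revert y Hy; total_field. }
  assert (Q1 : forall x, jp x <> 0 -> total F_eq (pd_q F_eq) x
     = -6 * (jq x * jr x / jp x ^ 2 - jq x ^ 3 / jp x ^ 3)).
  { intros y Hy. rewrite (total_ext _ _ _ pd_q_F_eq y Hy).
    revert y Hy; total_field. }
  assert (Q2 : forall x, jp x <> 0 -> total F_eq (total F_eq (pd_q F_eq)) x
     = -6 * (jr x ^ 2 / jp x ^ 2 - jq x ^ 2 * jr x / jp x ^ 3)).
  { intros y Hy. rewrite (total_ext _ _ _ Q1 y Hy).
    revert y Hy; total_field. }
  unfold W1, W0.
  rewrite R3, R2, R1, Q2, Q1, pd_r_F_eq, pd_q_F_eq, pd_p_F_eq by assumption.
  destruct x as [[[[t u] p] q] r]; simpl in *; split; field; auto.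
Qed.

(** * Fundamental solutions of [y'' + k y = 0] *)

(** [cs (x^2) = cos x] and [x sn (x^2) = sin x]. *)
Definition cs : R -> R := PSeries cos_n.
Definition sn : R -> R := PSeries sin_n.
Definition dsn : R -> R := PSeries (PS_derive sin_n).

Lemma CV_radius_cos_n : CV_radius cos_n = p_infty.
Proof.
  apply CV_radius_infinite_DAlembert.
  - exact cosn_no_R0.
  - apply is_lim_seq_Reals, Alembert_cos.
Qed.

Lemma CV_radius_sin_n : CV_radius sin_n = p_infty.
Proof.
  apply CV_radius_infinite_DAlembert.
  - exact sin_no_R0.
  - apply is_lim_seq_Reals, Alembert_sin.
Qed.

Lemma fact_2S n : INR (Factorial.fact (2 * S n))
  = (2 * INR n + 2) * (2 * INR n + 1) * INR (Factorial.fact (2 * n)).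
Proof.
  replace (2 * S n)%nat with (S (S (2 * n))) by lia.
  rewrite !fact_simpl, !mult_INR, !S_INR, mult_INR. simpl (INR 2). ring.
Qed.

Lemma fact_2Sp n : INR (Factorial.fact (2 * n + 1))
  = (2 * INR n + 1) * INR (Factorial.fact (2 * n)).
Proof.
  replace (2 * n + 1)%nat with (S (2 * n)) by lia.
  rewrite fact_simpl, mult_INR, S_INR, mult_INR. simpl (INR 2). ring.
Qed.

(** Termwise differentiation: the coefficients satisfy [(n+1) cos_n (n+1) = - sin_n n / 2]. *)
Lemma is_derive_cs z : is_derive cs z (- sn z / 2).
Proof.
  replace (- sn z / 2) with (PSeries (PS_derive cos_n) z).
  - apply is_derive_PSeries. now rewrite CV_radius_cos_n.
  - replace (- sn z / 2) with (PSeries (PS_scal (-1/2) sin_n) z)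
      by (rewrite PSeries_scal; unfold sn; field).
    apply PSeries_ext; intros n.
    change (INR (S n) * ((-1) ^ S n / INR (Factorial.fact (2 * S n)))
      = -1/2 * ((-1) ^ n / INR (Factorial.fact (2 * n + 1)))).
    rewrite fact_2S, fact_2Sp, <- tech_pow_Rmult, S_INR.
    pose proof (INR_fact_neq_0 (2 * n)). pose proof (pos_INR n).
    field. repeat split; auto; lra.
Qed.

Lemma is_derive_sn z : is_derive sn z (dsn z).
Proof. apply is_derive_PSeries. now rewrite CV_radius_sin_n. Qed.

(** In the variable [z = x^2] this is [x (sin x / x)' = cos x - sin x / x]. It is proved on
    coefficients, where it says [2 n sin_n n = cos_n n - sin_n n], and so holds for every sign of
    [z]. *)
Lemma dsn_eq z : 2 * z * dsn z = cs z - sn z.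
Proof.
  assert (Hd : CV_radius (PS_derive sin_n) = p_infty)
    by now rewrite CV_radius_derive, CV_radius_sin_n.
  unfold cs, sn, dsn.
  rewrite Rmult_assoc, <- (PSeries_incr_1), <- PSeries_scal, <- PSeries_minus.
  - apply PSeries_ext; intros [|n].
    + unfold PS_scal, PS_incr_1, PS_minus, PS_plus, PS_opp, cos_n, sin_n; simpl.
      unfold scal, plus, opp, zero; simpl; unfold mult; simpl. field.
    + unfold PS_scal, PS_incr_1, PS_minus, PS_plus, PS_opp, PS_derive, cos_n, sin_n.
      unfold scal, plus, opp, zero; simpl plus; unfold mult; simpl mult.
      set (m := S n). rewrite fact_2Sp.
      pose proof (INR_fact_neq_0 (2 * m)). pose proof (pos_INR m).
      change (2 * (INR m * ((-1) ^ m / ((2 * INR m + 1) * INR (Factorial.fact (2 * m)))))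
       = (-1) ^ m / INR (Factorial.fact (2 * m))
         + - ((-1) ^ m / ((2 * INR m + 1) * INR (Factorial.fact (2 * m))))).
      field. split; auto; lra.
  - apply CV_disk_correct, CV_disk_inside. now rewrite CV_radius_cos_n.
  - apply CV_disk_correct, CV_disk_inside. now rewrite CV_radius_sin_n.
Qed.

Lemma cs_0 : cs 0 = 1.
Proof. unfold cs; rewrite PSeries_0; unfold cos_n; simpl; field. Qed.

Lemma sn_0 : sn 0 = 1.
Proof. unfold sn; rewrite PSeries_0; unfold sin_n; simpl; field. Qed.

Lemma dsn_0 : dsn 0 = -1/6.
Proof. unfold dsn; rewrite PSeries_0; unfold PS_derive, sin_n; simpl; field. Qed.

Lemma cos_cs x : cos x = cs (Rsqr x).
Proof.
  unfold cos. destruct (exist_cos (Rsqr x)) as [c Hc].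
  symmetry. now apply is_pseries_unique, is_pseries_Reals.
Qed.

Lemma sin_sn x : sin x = x * sn (Rsqr x).
Proof.
  unfold sin. destruct (exist_sin (Rsqr x)) as [c Hc].
  f_equal. symmetry. now apply is_pseries_unique, is_pseries_Reals.
Qed.

Opaque cs sn dsn.

Lemma eq_of_is_derive_0 (f : R -> R) (a b : R) :
  (forall t, Rmin a b <= t <= Rmax a b -> is_derive f t 0) -> f a = f b.
Proof.
  intros H. destruct (MVT_gen f a b (fun _ => 0)) as [c [_ Hc]].
  - intros; apply H; lra.
  - intros t Ht. apply derivable_continuous_pt. exists 0.
    now apply is_derive_Reals, H.
  - lra.
Qed.

(** One identity for the circular case [z > 0] and the hyperbolic case [z < 0]: the left side has
    zero derivative by [dsn_eq], and equals 1 at 0. *)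
Lemma cs_sn z : cs z ^ 2 + z * sn z ^ 2 = 1.
Proof.
  rewrite (eq_of_is_derive_0 (fun z => cs z ^ 2 + z * sn z ^ 2) z 0).
  - rewrite cs_0. ring.
  - intros t _. evar_last.
    + apply (is_derive_plus (fun z => cs z ^ 2) (fun z => z * sn z ^ 2)).
      * apply (is_derive_pow cs 2), is_derive_cs.
      * apply (is_derive_mult (fun z => z) (fun z => sn z ^ 2)).
        -- apply is_derive_id.
        -- apply (is_derive_pow sn 2), is_derive_sn.
        -- exact Rmult_comm.
    + unfold plus, one; simpl; unfold mult; simpl.
      transitivity (sn t * (2 * t * dsn t - (cs t - sn t))); [field|].
      rewrite dsn_eq; ring.
Qed.

Tactic Notation "rewrite_Derive" "by" tactic3(tac) :=
  repeat match goal with |- context [Derive ?f ?x] =>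
    let H := fresh in
    eassert (H : Derive f x = _) by (apply is_derive_unique; tac);
    rewrite H; clear H
  end.

(** [Cg k] and [Sg k] solve [y'' + k y = 0]; [Eg] is the derivative of [Sg] in [k]. *)
Definition Cg (k s : R) : R := cs (k * s ^ 2).
Definition Sg (k s : R) : R := s * sn (k * s ^ 2).
Definition Eg (k s : R) : R := s ^ 3 * dsn (k * s ^ 2).

Lemma Cg_0 k : Cg k 0 = 1.
Proof. unfold Cg; rewrite <- cs_0; f_equal; ring. Qed.

Lemma Sg_0 k : Sg k 0 = 0.
Proof. unfold Sg; ring. Qed.

Lemma Cg_Sg k s : Cg k s ^ 2 + k * Sg k s ^ 2 = 1.
Proof. unfold Cg, Sg; rewrite <- (cs_sn (k * s ^ 2)); ring. Qed.

Lemma Eg_eq k s : 2 * k * Eg k s = s * Cg k s - Sg k s.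
Proof.
  unfold Eg, Cg, Sg.
  transitivity (s * (2 * (k * s ^ 2) * dsn (k * s ^ 2))); [ring|].
  rewrite dsn_eq; ring.
Qed.

Lemma is_derive_Cg k s : is_derive (Cg k) s (- k * Sg k s).
Proof.
  unfold Cg, Sg. evar_last.
  - apply (is_derive_comp cs (fun s => k * s ^ 2)).
    + apply is_derive_cs.
    + auto_derive; [exact I|reflexivity].
  - unfold scal; simpl; unfold mult; simpl. field.
Qed.

Lemma is_derive_Sg k s : is_derive (Sg k) s (Cg k s).
Proof.
  unfold Cg, Sg. evar_last.
  - apply (is_derive_mult (fun s => s) (fun s => sn (k * s ^ 2))).
    + apply is_derive_id.
    + apply (is_derive_comp sn (fun s => k * s ^ 2)).
      * apply is_derive_sn.
      * auto_derive; [exact I|reflexivity].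
    + intros; apply Rmult_comm.
  - unfold scal, plus, one; simpl; unfold mult; simpl.
    pose proof (dsn_eq (k * (s * (s * 1)))) as E.
    replace (cs (k * (s * (s * 1)))) with
      (2 * (k * (s * (s * 1))) * dsn (k * (s * (s * 1))) + sn (k * (s * (s * 1))))
      by (rewrite E; ring).
    ring.
Qed.

Lemma is_derive_Cg_param k s : is_derive (fun k => Cg k s) k (- s * Sg k s / 2).
Proof.
  unfold Cg, Sg. evar_last.
  - apply (is_derive_comp cs (fun k => k * s ^ 2)).
    + apply is_derive_cs.
    + auto_derive; [exact I|reflexivity].
  - unfold scal; simpl; unfold mult; simpl. field.
Qed.

Lemma is_derive_Sg_param k s : is_derive (fun k => Sg k s) k (Eg k s).
Proof.
  unfold Sg, Eg. evar_last.
  - apply (is_derive_scal (fun k => sn (k * s ^ 2))).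
    apply (is_derive_comp sn (fun k => k * s ^ 2)).
    + apply is_derive_sn.
    + auto_derive; [exact I|reflexivity].
  - unfold scal; simpl; unfold mult; simpl. ring.
Qed.

Lemma Cg_pos w s : Cg (w ^ 2) s = cos (w * s).
Proof. rewrite cos_cs. unfold Cg. f_equal. unfold Rsqr; ring. Qed.

Lemma Sg_pos w s : w * Sg (w ^ 2) s = sin (w * s).
Proof.
  rewrite sin_sn. unfold Sg.
  replace (Rsqr (w * s)) with (w ^ 2 * s ^ 2) by (unfold Rsqr; ring). ring.
Qed.

(** The left side solves [y' = w y] with [y 0 = 1], so its product with [exp (- (w * s))] is
    constant. *)
Lemma Cg_Sg_neg w s : Cg (- w ^ 2) s + w * Sg (- w ^ 2) s = exp (w * s).
Proof.
  assert (E : (Cg (- w ^ 2) s + w * Sg (- w ^ 2) s) * exp (- (w * s)) = 1).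
  { rewrite (eq_of_is_derive_0
      (fun s => (Cg (- w ^ 2) s + w * Sg (- w ^ 2) s) * exp (- (w * s))) s 0).
    - rewrite Cg_0, Sg_0, !Rmult_0_r, Ropp_0, exp_0. ring.
    - intros t _. evar_last.
      + auto_derive; [|reflexivity].
        repeat split; [exists (- (- w ^ 2) * Sg (- w ^ 2) t); apply is_derive_Cg
          | exists (Cg (- w ^ 2) t); apply is_derive_Sg].
      + rewrite_Derive by (idtac; lazymatch goal with
          |- is_derive (fun _ => Cg _ _) _ _ => apply is_derive_Cg | _ => apply is_derive_Sg end).
        ring. }
  rewrite exp_Ropp in E. pose proof (exp_pos (w * s)).
  apply (Rmult_eq_reg_r (/ exp (w * s))); [rewrite E; field; lra|].
  apply Rinv_neq_0_compat; lra.
Qed.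

(** * Differentiation of pairs and of their components *)

Lemma filterdiff_pair {U V W : NormedModule R_AbsRing} (F : (U -> Prop) -> Prop)
    {HF : Filter F} (f : U -> V) (g : U -> W) (lf : U -> V) (lg : U -> W) :
  filterdiff f F lf -> filterdiff g F lg ->
  filterdiff (fun x => (f x, g x)) F (fun x => (lf x, lg x)).
Proof.
  intros Hf Hg.
  apply (filterdiff_comp_2 f g pair lf lg pair Hf Hg).
  apply filterdiff_linear, is_linear_prod; [apply is_linear_fst | apply is_linear_snd].
Qed.

Lemma is_derive_pair {V W : NormedModule R_AbsRing} (f : R -> V) (g : R -> W)
    (x : R) (df : V) (dg : W) :
  is_derive f x df -> is_derive g x dg ->
  is_derive (fun h => (f h, g h)) x (df, dg).
Proof. apply filterdiff_pair. apply locally_filter. Qed.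

Lemma is_derive_linear {V W : NormedModule R_AbsRing} (f : R -> V) (l : V -> W)
    (x : R) (df : V) :
  is_linear l -> is_derive f x df -> is_derive (fun h => l (f h)) x (l df).
Proof.
  intros Hl Hf. unfold is_derive.
  apply (filterdiff_ext_lin _ (fun y : R => l (scal y df))).
  - apply (filterdiff_comp' f l); [exact Hf|now apply filterdiff_linear].
  - intros y; apply (linear_scal l Hl).
Qed.

Lemma is_derive_fst {V W : NormedModule R_AbsRing} (f : R -> V * W) (x : R) (d : V * W) :
  is_derive f x d -> is_derive (fun h => fst (f h)) x (fst d).
Proof. apply (is_derive_linear f fst), is_linear_fst. Qed.

Lemma is_derive_snd {V W : NormedModule R_AbsRing} (f : R -> V * W) (x : R) (d : V * W) :
  is_derive f x d -> is_derive (fun h => snd (f h)) x (snd d).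
Proof. apply (is_derive_linear f snd), is_linear_snd. Qed.

Ltac split_conj := repeat match goal with |- _ /\ _ => split end.

(* [apply] does not fail quickly on [is_derive f] against [is_derive g], so the
   hypothesis is selected syntactically. *)
Ltac known_derive :=
  lazymatch goal with |- is_derive (fun x => ?f x) ?t ?d => change (is_derive f t d) | _ => idtac end;
  lazymatch goal with
  | H : forall z, _ -> @is_derive _ _ ?f z _ |- @is_derive _ _ ?f _ _ => apply H; assumption
  | H : forall z, @is_derive _ _ ?f z _ |- @is_derive _ _ ?f _ _ => apply H
  end.

(** * The flow of [X_F] *)

(** [den k b] is [v / v 0] and [slope k b] is [- v' / v] for the solution
    [v] of [v'' + k v = 0] with [v' 0 / v 0 = - b]. *)
Definition den (k b s : R) : R := Cg k s - b * Sg k s.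
Definition slope (k b s : R) : R := (k * Sg k s + b * Cg k s) / den k b s.

Lemma den_0 k b : den k b 0 = 1.
Proof. unfold den; rewrite Cg_0, Sg_0; ring. Qed.

Lemma is_derive_den k b s : is_derive (den k b) s (- (k * Sg k s + b * Cg k s)).
Proof.
  unfold den. evar_last.
  - apply (is_derive_minus (Cg k) (fun s => b * Sg k s)).
    + apply is_derive_Cg.
    + apply (is_derive_scal (Sg k)), is_derive_Sg.
  - unfold minus, plus, opp, scal; simpl; unfold mult; simpl. ring.
Qed.

(** The Riccati equation of [- v' / v] for a solution of [v'' + k v = 0]. *)
Lemma is_derive_slope k b s : den k b s <> 0 ->
  is_derive (slope k b) s (k + slope k b s ^ 2).
Proof.
  intros Hd. unfold slope at 1. evar_last.
  - apply (is_derive_div (fun s => k * Sg k s + b * Cg k s) (den k b)); [|apply is_derive_den|exact Hd].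
    apply (is_derive_plus (fun s => k * Sg k s) (fun s => b * Cg k s)).
    + apply (is_derive_scal (Sg k)), is_derive_Sg.
    + apply (is_derive_scal (Cg k)), is_derive_Cg.
  - unfold plus, scal; simpl; unfold mult; simpl. unfold slope, den in *. field. exact Hd.
Qed.

(** The numerator of the quotient rule is the Wronskian of [den k b] and [Sg k], which is 1. This
    makes [Sg / den] the primitive needed to recover [u] from [p]. *)
Lemma is_derive_Sg_den k b s : den k b s <> 0 ->
  is_derive (fun s => Sg k s / den k b s) s (/ den k b s ^ 2).
Proof.
  intros Hd. evar_last.
  - apply (is_derive_div (Sg k) (den k b)); [apply is_derive_Sg|apply is_derive_den|exact Hd].
  - replace (Cg k s * den k b s - Sg k s * - (k * Sg k s + b * Cg k s)) with 1
      by (rewrite <- (Cg_Sg k s); unfold den; ring).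
    field. exact Hd.
Qed.

(** With [v = |p|^(-1/2)], [kap] is the constant in [v'' + k v = 0] and [beta] below is
    [- v' / v]. *)
Definition kap (x : J3) : R := Schwarzian x / 2.
Definition beta (x : J3) : R := jq x / (2 * jp x).
Definition xden (x : J3) : R -> R := den (kap x) (beta x).

(** The last two components invert [beta] and [kap]: [q = 2 p b] and [r = p (2 k + 6 b^2)]. Past a
    zero of [den] the formula leaves the integral curve of [x], although it still has a value. *)
Definition flow (x : J3) (s : R) : J3 :=
  let '(t, u, p, q, r) := x in
  let k := kap x in let b := beta x in
  let p1 := p / den k b s ^ 2 in let b1 := slope k b s in
  (t + s, u + p * (Sg k s / den k b s), p1, 2 * p1 * b1, p1 * (2 * k + 6 * b1 ^ 2)).

Lemma flow_0 x : jp x <> 0 -> flow x 0 = x.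
Proof.
  destruct x as [[[[t u] p] q] r]; intros Hp; simpl in Hp.
  unfold flow. rewrite Sg_0. unfold slope. rewrite den_0, Sg_0, Cg_0.
  unfold kap, beta, Schwarzian; simpl. repeat f_equal; field; auto.
Qed.

Lemma jp_flow_neq_0 x s : jp x <> 0 -> xden x s <> 0 -> jp (flow x s) <> 0.
Proof.
  destruct x as [[[[t u] p] q] r]; simpl; intros Hp Hd.
  apply Rmult_integral_contrapositive_currified; [exact Hp|].
  apply Rinv_neq_0_compat, (pow_nonzero _ 2), Hd.
Qed.

Lemma is_derive_flow x s : jp x <> 0 -> xden x s <> 0 ->
  is_derive (flow x) s (XF F_eq (flow x s)).
Proof.
  destruct x as [[[[t u] p] q] r]. unfold xden. unfold flow at 1.
  set (x := (t, u, p, q, r)). set (k := kap x). set (b := beta x).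
  simpl. intros Hp Hd.
  assert (Dp : is_derive (fun s => p / den k b s ^ 2) s
                 (2 * (p / den k b s ^ 2) * slope k b s)).
  { evar_last.
    - apply (is_derive_scal (fun s => / den k b s ^ 2)).
      apply (is_derive_inv (fun s => den k b s ^ 2)); [|now apply pow_nonzero].
      apply (is_derive_pow (den k b) 2), is_derive_den.
    - unfold scal; simpl; unfold mult; simpl. unfold slope. field. exact Hd. }
  pose proof (is_derive_slope k b s Hd) as Ds.
  unfold XF. unfold flow, x. fold x k b. simpl jp. simpl jq. simpl jr.
  repeat apply is_derive_pair.
  - auto_derive; [exact I|reflexivity].
  - evar_last.
    + apply (is_derive_plus (fun _ => u) (fun s => p * (Sg k s / den k b s)));
        [apply is_derive_const|].
      apply (is_derive_scal (fun s => Sg k s / den k b s)), is_derive_Sg_den, Hd.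
    + unfold plus, zero; simpl. field. exact Hd.
  - exact Dp.
  - evar_last.
    + apply (is_derive_mult (fun s => 2 * (p / den k b s ^ 2)) (slope k b)).
      * apply (is_derive_scal (fun s => p / den k b s ^ 2)), Dp.
      * exact Ds.
      * intros; apply Rmult_comm.
    + unfold plus; simpl; unfold mult; simpl. field. exact Hd.
  - evar_last.
    + apply (is_derive_mult (fun s => p / den k b s ^ 2) (fun s => 2 * k + 6 * slope k b s ^ 2)).
      * exact Dp.
      * apply (is_derive_plus (fun _ => 2 * k) (fun s => 6 * slope k b s ^ 2)); [apply is_derive_const|].
        apply (is_derive_scal (fun s => slope k b s ^ 2)), (is_derive_pow (slope k b) 2), Ds.
      * intros; apply Rmult_comm.
    + unfold plus, zero; simpl; unfold mult; simpl. field. auto.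
Qed.

Lemma is_derive_J3_components (g : R -> J3) (F : J3 -> R) (h : R) :
  is_derive g h (XF F (g h)) ->
  let pr (i : J3 -> R) d := is_derive (fun h => i (g h)) h d in
  pr jt 1 /\ pr (fun x => let '(t, u, p, q, r) := x in u) (jp (g h)) /\
  pr jp (jq (g h)) /\ pr jq (jr (g h)) /\ pr jr (F (g h)).
Proof.
  unfold XF. intros H. simpl.
  pose proof (is_derive_fst _ _ _ H) as H1.
  pose proof (is_derive_fst _ _ _ H1) as H2.
  pose proof (is_derive_fst _ _ _ H2) as H3.
  refine (conj _ (conj _ (conj _ (conj _ _)))).
  - apply is_derive_fst in H3. refine (is_derive_ext _ _ _ _ _ H3).
    intros z; now destruct (g z) as [[[[? ?] ?] ?] ?].
  - apply is_derive_snd in H3. refine (is_derive_ext _ _ _ _ _ H3).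
    intros z; now destruct (g z) as [[[[? ?] ?] ?] ?].
  - apply is_derive_snd in H2. refine (is_derive_ext _ _ _ _ _ H2).
    intros z; now destruct (g z) as [[[[? ?] ?] ?] ?].
  - apply is_derive_snd in H1. refine (is_derive_ext _ _ _ _ _ H1).
    intros z; now destruct (g z) as [[[[? ?] ?] ?] ?].
  - apply is_derive_snd in H. refine (is_derive_ext _ _ _ _ _ H).
    intros z; now destruct (g z) as [[[[? ?] ?] ?] ?].
Qed.

(** Uniqueness of solutions, obtained from conserved quantities instead of a general theorem on
    differential equations. It also yields that [xden] cannot vanish along an integral curve, which
    bounds the interval of definition. *)
Lemma integral_curve_flow (a b : R) (g : R -> J3) (h0 h : R) :
  is_integral_curve F_eq a b g -> a < h0 < b -> a < h < b ->
  xden (g h0) (h - h0) <> 0 /\ g h = flow (g h0) (h - h0).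
Proof.
  intros Hg Hh0 Hh.
  set (ut := fun x : J3 => let '(t, u, p, q, r) := x in u).
  set (T := fun h => jt (g h)). set (U := fun h => ut (g h)).
  set (P := fun h => jp (g h)). set (Q := fun h => jq (g h)). set (Rr := fun h => jr (g h)).
  assert (Eg' : forall h, g h = (T h, U h, P h, Q h, Rr h))
    by (intros z; unfold T, U, P, Q, Rr; now destruct (g z) as [[[[? ?] ?] ?] ?]).
  assert (HP0 : forall z, a < z < b -> P z <> 0) by (intros z Hz; now apply Hg).
  assert (HT : forall z, a < z < b -> is_derive T z 1)
    by (intros z Hz; now apply (is_derive_J3_components g F_eq z), Hg).
  assert (HU : forall z, a < z < b -> is_derive U z (P z))
    by (intros z Hz; now apply (is_derive_J3_components g F_eq z), Hg).
  assert (HP : forall z, a < z < b -> is_derive P z (Q z))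
    by (intros z Hz; now apply (is_derive_J3_components g F_eq z), Hg).
  assert (HQ : forall z, a < z < b -> is_derive Q z (Rr z))
    by (intros z Hz; now apply (is_derive_J3_components g F_eq z), Hg).
  assert (HR : forall z, a < z < b ->
     is_derive Rr z (- 3 * (Q z ^ 3 / P z ^ 2) + 4 * (Q z * Rr z / P z))).
  { intros z Hz. replace (- 3 * (Q z ^ 3 / P z ^ 2) + 4 * (Q z * Rr z / P z)) with (F_eq (g z)).
    - now apply (is_derive_J3_components g F_eq z), Hg.
    - now rewrite Eg'. }
  clearbody T U P Q Rr.
  assert (Hconst : forall f : R -> R, (forall z, a < z < b -> is_derive f z 0) -> f h = f h0).
  { intros f Hf. apply eq_of_is_derive_0. intros t Ht. apply Hf.
    revert Ht. unfold Rmin, Rmax. destruct (Rle_dec h h0); lra. }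
  set (k := kap (g h0)). set (c := beta (g h0)).
  assert (Hk : forall z, a < z < b -> (Rr z / P z - 3 / 2 * (Q z / P z) ^ 2) / 2 = k).
  { intros z Hz. unfold k, kap. rewrite Eg'. simpl.
    symmetry. change (3 / 2 * (Q h0 / P h0 * (Q h0 / P h0 * 1))) with (3 / 2 * (Q h0 / P h0) ^ 2).
    apply (eq_of_is_derive_0 (fun z => (Rr z / P z - 3 / 2 * (Q z / P z) ^ 2) / 2) h0 z).
    intros t Ht.
    assert (Hta : a < t < b)
      by (revert Ht; unfold Rmin, Rmax; destruct (Rle_dec h0 z); lra).
    pose proof (HP0 t Hta). evar_last.
    - auto_derive; [|reflexivity].
      split_conj; auto; eexists; known_derive.
    - rewrite_Derive by known_derive.
      field. auto. }
  (* [D] is the solution of [v'' + k v = 0] to be compared with [|P|^(-1/2)], and [N] is [- D']. *)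
  pose (D := fun z => den k c (z - h0)).
  pose (N := fun z => k * Sg k (z - h0) + c * Cg k (z - h0)).
  assert (HD : forall z, is_derive D z (- N z)).
  { intros z. unfold D, N. evar_last.
    - apply (is_derive_comp (den k c) (fun z => z - h0)); [apply is_derive_den|].
      auto_derive; [exact I|reflexivity].
    - unfold scal; simpl; unfold mult; simpl. ring. }
  assert (HN : forall z, is_derive N z (k * D z)).
  { intros z. unfold D, N, den. evar_last.
    - apply (is_derive_comp (fun s => k * Sg k s + c * Cg k s) (fun z => z - h0)).
      + apply (is_derive_plus (fun s => k * Sg k s) (fun s => c * Cg k s)).
        * apply (is_derive_scal (Sg k)), is_derive_Sg.
        * apply (is_derive_scal (Cg k)), is_derive_Cg.
      + auto_derive; [exact I|reflexivity].
    - unfold plus, scal; simpl; unfold mult; simpl. ring. }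
  assert (HD0 : D h0 = 1) by (unfold D; rewrite Rminus_diag; apply den_0).
  assert (HN0 : N h0 = c) by (unfold N; rewrite Rminus_diag, Sg_0, Cg_0; ring).
  assert (Hc : c = Q h0 / (2 * P h0)) by (unfold c, beta; now rewrite Eg').
  assert (HG : forall z, a < z < b -> Q z * D z - 2 * P z * N z = 0).
  { intros z Hz.
    (* Up to sign and a factor 4, this is the square of the Wronskian of [|P|^(-1/2)] and [D];
       squaring avoids the root. It is constant and vanishes at [h0] by the choice of [c]. *)
    assert (E : (Q z * D z - 2 * P z * N z) ^ 2 / P z ^ 3 = 0).
    { rewrite (eq_of_is_derive_0 (fun z => (Q z * D z - 2 * P z * N z) ^ 2 / P z ^ 3) z h0).
      - rewrite HD0, HN0, Hc. field. now apply HP0.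
      - intros t Ht.
        assert (Hta : a < t < b)
          by (revert Ht; unfold Rmin, Rmax; destruct (Rle_dec z h0); lra).
        pose proof (HP0 t Hta). evar_last.
        + auto_derive; [|reflexivity].
          split_conj; auto using Rmult_integral_contrapositive_currified, R1_neq_R0;
            eexists; known_derive.
        + rewrite_Derive by known_derive.
          rewrite <- (Hk t Hta). field. auto. }
    apply Rmult_integral in E. destruct E as [E|E].
    - apply Rsqr_0_uniq. unfold Rsqr. rewrite <- E. ring.
    - exfalso. revert E. now apply Rinv_neq_0_compat, pow_nonzero, HP0. }
  assert (HPD : forall z, a < z < b -> P z * D z ^ 2 = P h0).
  { intros z Hz. rewrite (eq_of_is_derive_0 (fun z => P z * D z ^ 2) z h0).
    - rewrite HD0. ring.
    - intros t Ht.
      assert (Hta : a < t < b)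
        by (revert Ht; unfold Rmin, Rmax; destruct (Rle_dec z h0); lra).
      evar_last.
      + auto_derive; [|reflexivity].
        split_conj; auto; eexists; known_derive.
      + rewrite_Derive by known_derive.
        transitivity (D t * (Q t * D t - 2 * P t * N t)); [ring|].
        rewrite HG by assumption. ring. }
  assert (HDn : forall z, a < z < b -> D z <> 0).
  (* A zero of [D] would make the conserved quantity [P * D ^ 2], hence [P h0], vanish. *)
  { intros z Hz E. apply (HP0 h0 Hh0). rewrite <- (HPD z Hz), E. ring. }
  assert (EP : P h = P h0 / D h ^ 2)
    by (rewrite <- (HPD h Hh); field; now apply HDn).
  assert (EQ : Q h = 2 * P h * (N h / D h)).
  { pose proof (HG h Hh). pose proof (HDn h Hh).
    apply (Rmult_eq_reg_r (D h)); [|assumption].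
    transitivity (2 * P h * N h); [lra|field; assumption]. }
  split; [exact (HDn h Hh)|].
  rewrite (Eg' h). rewrite (Eg' h0) at 1. unfold flow. rewrite <- (Eg' h0).
  fold k c. change (den k c (h - h0)) with (D h).
  change (slope k c (h - h0)) with (N h / D h).
  rewrite <- EP, <- EQ.
  repeat f_equal.
  - enough (T h - h = T h0 - h0) by lra.
    apply (Hconst (fun z => T z - z)). intros z Hz. evar_last.
    + apply (is_derive_minus T (fun z => z)); [now apply HT|apply is_derive_id].
    + unfold minus, plus, opp, one; simpl. ring.
  - enough (U h - P h0 * (Sg k (h - h0) / D h) = U h0 - P h0 * (Sg k (h0 - h0) / D h0)) as E.
    { rewrite (Rminus_diag h0), Sg_0, HD0 in E. lra. }
    apply (Hconst (fun z => U z - P h0 * (Sg k (z - h0) / D z))). intros z Hz. evar_last.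
    + apply (is_derive_minus U (fun z => P h0 * (Sg k (z - h0) / D z))); [now apply HU|].
      apply (is_derive_scal (fun z => Sg k (z - h0) / D z)).
      apply (is_derive_comp (fun s => Sg k s / den k c s) (fun z => z - h0)).
      * apply is_derive_Sg_den. now apply HDn.
      * auto_derive; [exact I|reflexivity].
    + unfold minus, plus, opp, scal; simpl; unfold mult; simpl.
      change (den k c (z - h0)) with (D z). rewrite <- (HPD z Hz).
      field. now apply HDn.
  - pose proof (HP0 h Hh). pose proof (HDn h Hh).
    replace (N h / D h) with (Q h / (2 * P h)) by (rewrite EQ; field; auto).
    rewrite <- (Hk h Hh). field. assumption.
Qed.

Lemma kap_flow x s : jp x <> 0 -> xden x s <> 0 -> kap (flow x s) = kap x.
Proof.
  destruct x as [[[[t u] p] q] r]; intros Hp Hd.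
  unfold flow. unfold kap at 1. unfold Schwarzian.
  set (k := kap (t, u, p, q, r)). set (b := beta (t, u, p, q, r)).
  change (den k b s <> 0) in Hd. simpl in Hp. field. auto.
Qed.

Lemma beta_flow x s : jp x <> 0 -> xden x s <> 0 ->
  beta (flow x s) = slope (kap x) (beta x) s.
Proof.
  destruct x as [[[[t u] p] q] r]; intros Hp Hd.
  unfold flow. unfold beta at 1. simpl jp. simpl jq.
  set (k := kap (t, u, p, q, r)). set (b := beta (t, u, p, q, r)).
  change (den k b s <> 0) in Hd. simpl in Hp. field. auto.
Qed.

Lemma jp_flow x s : jp (flow x s) = jp x / xden x s ^ 2.
Proof. now destruct x as [[[[t u] p] q] r]. Qed.

Lemma jt_flow x s : jt (flow x s) = jt x + s.
Proof. now destruct x as [[[[t u] p] q] r]. Qed.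

(** The maximal integral curve through [x] contains a point over time [jt x + s]. *)
Definition reaches (x : J3) (s : R) : Prop := forall w, 0 <= w <= 1 -> xden x (w * s) <> 0.

(** The joining curve lives on an interval, so it passes over every intermediate time, and
    [integral_curve_flow] applies at each of them. *)
Lemma pi_inv x y : pi F_eq x y ->
  jp x <> 0 /\ exists s, reaches x s /\ xden x s <> 0 /\ y = flow x s.
Proof.
  intros (a & b & g & h & k & Hg & Hh & Hk & <- & <-).
  split; [now apply Hg|]. exists (k - h). split.
  - intros w Hw. replace (w * (k - h)) with (h + w * (k - h) - h) by ring.
    apply (integral_curve_flow a b g h _ Hg Hh).
    destruct (Rle_dec h k);
      [assert (0 <= w * (k - h) <= k - h)|assert (k - h <= w * (k - h) <= 0)];
      (split; nra) || lra.
  - now apply (integral_curve_flow a b g).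
Qed.

Lemma xden_neq_0_nbhd x s : xden x s <> 0 ->
  exists e : posreal, forall z, Rabs (z - s) < e -> xden x z <> 0.
Proof.
  intros H.
  assert (C : continuous (xden x) s)
    by (apply (ex_derive_continuous (xden x)); eexists; apply is_derive_den).
  destruct (C _ (open_neq 0 (xden x s) H)) as [e He].
  exists e. intros z Hz. now apply He.
Qed.

(** Integral curves are taken on open intervals, so the closed segment from 0 to [s] is thickened at
    both ends by continuity of [xden x]. *)
Lemma reaches_interval x s : reaches x s ->
  exists a b, a < 0 < b /\ a < s < b /\ forall z, a < z < b -> xden x z <> 0.
Proof.
  intros H.
  destruct (xden_neq_0_nbhd x 0) as [e0 H0].
  { unfold xden. rewrite den_0. lra. }
  destruct (xden_neq_0_nbhd x s) as [e1 H1].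
  { rewrite <- (Rmult_1_l s). apply H; lra. }
  pose proof (cond_pos e0). pose proof (cond_pos e1).
  assert (Hull : forall z, Rmin 0 s <= z <= Rmax 0 s -> xden x z <> 0).
  { intros z Hz. destruct (Req_dec s 0) as [->|Hs].
    - replace z with 0 by (revert Hz; unfold Rmin, Rmax; destruct (Rle_dec 0 0); lra).
      apply H0. rewrite Rminus_diag, Rabs_R0; lra.
    - replace z with (z / s * s) by (field; exact Hs). apply H.
      revert Hz. unfold Rmin, Rmax. destruct (Rle_dec 0 s); intros Hz.
      + assert (0 < s) by lra.
        split; [apply Rcomplements.Rdiv_le_0_compat; lra|].
        apply (Rmult_le_reg_r s); [lra|]. field_simplify; lra.
      + assert (s < 0) by lra. replace (z / s) with ((- z) / (- s)) by (field; lra).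
        split; [apply Rcomplements.Rdiv_le_0_compat; lra|].
        apply (Rmult_le_reg_r (- s)); [lra|]. field_simplify; lra. }
  (* The minimum and maximum cover both signs of [s]: every point in between is near 0, near [s], or
     in the segment. *)
  exists (Rmin (- e0) (s - e1)), (Rmax e0 (s + e1)).
  assert (forall z, Rmin (- e0) (s - e1) < z < Rmax e0 (s + e1) ->
    Rabs (z - 0) < e0 \/ Rabs (z - s) < e1 \/ Rmin 0 s <= z <= Rmax 0 s) as Hz.
  { intros z. unfold Rmin, Rmax, Rabs.
    repeat match goal with |- context [Rle_dec ?a ?b] => destruct (Rle_dec a b) end;
    repeat match goal with |- context [Rcase_abs ?a] => destruct (Rcase_abs a) end;
    lra. }
  repeat split; try (unfold Rmin; destruct (Rle_dec (- e0) (s - e1)); lra);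
    try (unfold Rmax; destruct (Rle_dec e0 (s + e1)); lra).
  intros z Hz'. destruct (Hz z Hz') as [?|[?|?]]; auto.
Qed.

(** The curve [flow x] itself joins the two points. The intervals obtained for [s1] and [s2] both
    contain 0, so their union is an interval free of zeros of [xden x]. *)
Lemma pi_flow x s1 s2 : jp x <> 0 -> reaches x s1 -> reaches x s2 ->
  pi F_eq (flow x s1) (flow x s2).
Proof.
  intros Hp H1 H2.
  destruct (reaches_interval x s1 H1) as (a1 & b1 & ? & ? & D1).
  destruct (reaches_interval x s2 H2) as (a2 & b2 & ? & ? & D2).
  assert (Hd : forall h, Rmin a1 a2 < h < Rmax b1 b2 -> xden x h <> 0).
  { intros h. unfold Rmin, Rmax.
    destruct (Rle_dec a1 a2), (Rle_dec b1 b2), (Rle_dec h 0); intros;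
      (apply D1; lra) || (apply D2; lra). }
  pose proof (Rmin_l a1 a2). pose proof (Rmin_r a1 a2).
  pose proof (Rmax_l b1 b2). pose proof (Rmax_r b1 b2).
  exists (Rmin a1 a2), (Rmax b1 b2), (flow x), s1, s2.
  split; [|repeat split; lra].
  intros h Hh. split; [apply jp_flow_neq_0 | apply is_derive_flow]; auto.
Qed.

Lemma reaches_0 x : reaches x 0.
Proof. intros w _. unfold xden. rewrite Rmult_0_r, den_0. lra. Qed.

(** * Differentiability of the flow *)

Section Frechet.
Context {V : NormedModule R_AbsRing} (v : V).
Let fd (f : V -> R) := ex_filterdiff f (locally v).

Lemma ex_fd_const c : fd (fun _ => c).
Proof. apply (ex_filterdiff_const (V := R_NormedModule)). Qed.

Lemma ex_fd_plus f g : fd f -> fd g -> fd (fun x => f x + g x).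
Proof. apply (ex_filterdiff_plus_fct (V := R_NormedModule)). Qed.

Lemma ex_fd_minus f g : fd f -> fd g -> fd (fun x => f x - g x).
Proof. apply (ex_filterdiff_minus_fct (V := R_NormedModule)). Qed.

Lemma ex_fd_mult f g : fd f -> fd g -> fd (fun x => f x * g x).
Proof. apply (ex_filterdiff_mult_fct f g v Rmult_comm). Qed.

Lemma ex_fd_comp (phi : R -> R) f : ex_derive phi (f v) -> fd f -> fd (fun x => phi (f x)).
Proof.
  intros Hphi Hf. apply (ex_filterdiff_comp' f phi v Hf).
  now apply ex_derive_filterdiff.
Qed.

Lemma ex_fd_inv f : f v <> 0 -> fd f -> fd (fun x => / f x).
Proof.
  intros H. apply ex_fd_comp. auto_derive. exact H.
Qed.

Lemma ex_fd_div f g : g v <> 0 -> fd f -> fd g -> fd (fun x => f x / g x).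
Proof. intros H Hf Hg. apply ex_fd_mult; [exact Hf|now apply ex_fd_inv]. Qed.

Lemma ex_fd_pow f n : fd f -> fd (fun x => f x ^ n).
Proof.
  intros Hf. induction n as [|n IH]; simpl; [apply ex_fd_const|now apply ex_fd_mult].
Qed.

(** Joint differentiability in [k] and [s], with no exception at [k = 0], because [Cg] is an entire
    function of the single quantity [k s^2]. *)
Lemma ex_fd_Cg f g : fd f -> fd g -> fd (fun x => Cg (f x) (g x)).
Proof.
  intros Hf Hg. apply ex_fd_comp; [eexists; apply is_derive_cs|].
  apply ex_fd_mult; [exact Hf|now apply ex_fd_pow].
Qed.

Lemma ex_fd_Sg f g : fd f -> fd g -> fd (fun x => Sg (f x) (g x)).
Proof.
  intros Hf Hg. apply ex_fd_mult; [exact Hg|].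
  apply ex_fd_comp; [eexists; apply is_derive_sn|].
  apply ex_fd_mult; [exact Hf|now apply ex_fd_pow].
Qed.

Lemma ex_filterdiff_pair {W X : NormedModule R_AbsRing} (f : V -> W) (g : V -> X) :
  ex_filterdiff f (locally v) -> ex_filterdiff g (locally v) ->
  ex_filterdiff (fun x => (f x, g x)) (locally v).
Proof.
  intros [lf Hf] [lg Hg]. eexists. apply filterdiff_pair; [apply locally_filter|exact Hf|exact Hg].
Qed.

(** The jet and the time vary over an arbitrary normed space, so that the same rules serve both on
    [J3] and on [J3 * R], where the second factor rescales time. *)
Context (T U P Q S : V -> R) (s : V -> R)
  (HT : fd T) (HU : fd U) (HP : fd P) (HQ : fd Q) (HS : fd S) (Hs : fd s)
  (HP0 : P v <> 0).
Let X x : J3 := (T x, U x, P x, Q x, S x).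

Lemma ex_fd_kap : fd (fun x => kap (X x)).
Proof.
  unfold kap, Schwarzian; simpl.
  apply ex_fd_div; [lra| |apply ex_fd_const].
  apply ex_fd_minus; [now apply ex_fd_div|].
  apply ex_fd_mult; [apply ex_fd_const|].
  now apply (ex_fd_pow _ 2), ex_fd_div.
Qed.

Lemma ex_fd_beta : fd (fun x => beta (X x)).
Proof.
  unfold beta; simpl.
  apply ex_fd_div; [lra|assumption|].
  apply ex_fd_mult; [apply ex_fd_const|assumption].
Qed.

Lemma ex_fd_xden : fd (fun x => xden (X x) (s x)).
Proof.
  apply ex_fd_minus.
  - apply ex_fd_Cg; [apply ex_fd_kap|assumption].
  - apply ex_fd_mult; [apply ex_fd_beta|].
    apply ex_fd_Sg; [apply ex_fd_kap|assumption].
Qed.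

Lemma ex_fd_slope : xden (X v) (s v) <> 0 ->
  fd (fun x => slope (kap (X x)) (beta (X x)) (s x)).
Proof.
  intros H. apply ex_fd_div; [exact H| |apply ex_fd_xden].
  apply ex_fd_plus; apply ex_fd_mult;
    [apply ex_fd_kap|apply ex_fd_Sg|apply ex_fd_beta|apply ex_fd_Cg];
    assumption || apply ex_fd_kap.
Qed.

Lemma ex_filterdiff_flow : xden (X v) (s v) <> 0 ->
  ex_filterdiff (fun x => flow (X x) (s x)) (locally v).
Proof.
  intros H.
  assert (D : fd (fun x => P x / xden (X x) (s x) ^ 2)).
  { apply ex_fd_div; [now apply pow_nonzero|assumption|].
    apply ex_fd_pow, ex_fd_xden. }
  repeat apply ex_filterdiff_pair.
  - now apply ex_fd_plus.
  - apply ex_fd_plus; [assumption|]. apply ex_fd_mult; [assumption|].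
    apply ex_fd_div; [exact H| |apply ex_fd_xden].
    apply ex_fd_Sg; [apply ex_fd_kap|assumption].
  - exact D.
  - apply ex_fd_mult; [apply ex_fd_mult; [apply ex_fd_const|exact D]|].
    now apply ex_fd_slope.
  - apply ex_fd_mult; [exact D|].
    apply ex_fd_plus; (apply ex_fd_mult; [apply ex_fd_const|]).
    + apply ex_fd_kap.
    + now apply ex_fd_pow, ex_fd_slope.
Qed.
End Frechet.

(** The tube lemma for the compact interval [[0, 1]]: finitely many of the neighbourhoods around the
    points [(x, w)] suffice, hence a common radius in the first variable. *)
Lemma tube {U : UniformSpace} (f : U * R -> R) (x : U) :
  (forall w, 0 <= w <= 1 -> continuous f (x, w) /\ f (x, w) <> 0) ->
  locally x (fun x' => forall w, 0 <= w <= 1 -> f (x', w) <> 0).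
Proof.
  intros H.
  assert (H' : forall w, exists d : posreal, 0 <= w <= 1 ->
    forall x' w', ball x d x' -> ball w d w' -> f (x', w') <> 0).
  (* A radius must be chosen for every real [w]; outside [[0, 1]] the value 1 is a dummy. *)
  { intros w. destruct (Rle_dec 0 w), (Rle_dec w 1);
      try (exists (mkposreal 1 Rlt_0_1); intros; lra).
    destruct (H w) as [C N]; [lra|].
    destruct (C _ (open_neq 0 (f (x, w)) N)) as [d Hd].
    exists d. intros _ x' w' Hx Hw. apply (Hd (x', w')). now split. }
  destruct (ClassicalEpsilon.choice _ H') as [d Hd].
  destruct (compactness_value_1d 0 1 d) as [e He].
  exists e. intros x' Hx w Hw. apply Classical_Prop.NNPP; intros N.
  apply (He w Hw). intros (t & Ht & Hwt & Het).
  apply N, (Hd t Ht).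
  - now apply ball_le with e.
  - exact Hwt.
Qed.

(** * The canonical curve *)

(** [f = Gg k] solves [f''' + 4 k f' = 2] with zero 2-jet at [0]; one has
    [f' = Sg k ^ 2] and [f'' / 2 = Sg k * Cg k]. *)
Definition Gg (k s : R) : R := Eg k s * Cg k s + s * Sg k s ^ 2 / 2.

Lemma Gg_eq k s : 2 * k * Gg k s = s - Sg k s * Cg k s.
Proof.
  pose proof (Cg_Sg k s) as H2. pose proof (Eg_eq k s) as H1. unfold Gg.
  transitivity (2 * k * Eg k s * Cg k s + s * (k * Sg k s ^ 2)); [field|].
  rewrite H1. replace (k * Sg k s ^ 2) with (1 - Cg k s ^ 2) by lra. ring.
Qed.

Lemma is_derive_den_param k b s :
  is_derive (fun k => den k b s) k (- (s * Sg k s / 2 + b * Eg k s)).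
Proof.
  unfold den. evar_last.
  - apply (is_derive_minus (fun k => Cg k s) (fun k => b * Sg k s)).
    + apply is_derive_Cg_param.
    + apply (is_derive_scal (fun k => Sg k s)), is_derive_Sg_param.
  - unfold minus, plus, opp, scal; simpl; unfold mult; simpl. field.
Qed.

(** In the numerator of the quotient rule the terms in [b] cancel, leaving [Gg], which depends on
    [k] and [s] alone. *)
Lemma is_derive_Sg_den_param k b s : den k b s <> 0 ->
  is_derive (fun k => Sg k s / den k b s) k (Gg k s / den k b s ^ 2).
Proof.
  intros Hd. evar_last.
  - apply (is_derive_div (fun k => Sg k s) (fun k => den k b s));
      [apply is_derive_Sg_param|apply is_derive_den_param|exact Hd].
  - unfold Gg, den in *. field. exact Hd.
Qed.

(** Rewrites the variation of [den] in [k] through [slope k b s], a quantity of the end point, so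
    that the initial [b] enters only through the jet at the end. *)
Lemma den_param_eq k b s : den k b s <> 0 ->
  s * Sg k s / 2 + b * Eg k s
  = den k b s * (slope k b s * Gg k s + Sg k s ^ 2 / 2).
Proof.
  intros Hd. pose proof (Cg_Sg k s) as H2. pose proof (Eg_eq k s) as H1.
  unfold slope, Gg.
  transitivity ((k * Sg k s + b * Cg k s) * (Eg k s * Cg k s + s * Sg k s ^ 2 / 2)
     + Sg k s ^ 2 * den k b s / 2); [|field; exact Hd].
  unfold den. clear Hd.
  generalize dependent (Cg k s); generalize dependent (Sg k s); generalize dependent (Eg k s).
  intros E S C H2 H1.
  assert (r1 : 2 * k * E - s * C + S = 0) by lra.
  assert (r2 : C ^ 2 + k * S ^ 2 - 1 = 0) by lra.
  apply Rminus_diag_uniq_sym.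
  (* The difference of the two sides lies in the ideal generated by the relations [r1] and [r2]; the
     two cofactors are written out. *)
  transitivity ((S * C / 2 - b * S ^ 2 / 2) * (2 * k * E - s * C + S)
    + (s * S / 2 + b * E) * (C ^ 2 + k * S ^ 2 - 1)); [field|].
  rewrite r1, r2; ring.
Qed.

Lemma is_derive_inv_den_sqr_param k b s : den k b s <> 0 ->
  is_derive (fun k => / den k b s ^ 2) k
    (/ den k b s ^ 2 * (2 * slope k b s * Gg k s + Sg k s ^ 2)).
Proof.
  intros Hd. evar_last.
  - apply (is_derive_inv (fun k => den k b s ^ 2)); [|now apply pow_nonzero].
    apply (is_derive_pow (fun k => den k b s) 2), is_derive_den_param.
  - rewrite den_param_eq by exact Hd. simpl. field. exact Hd.
Qed.

(** The value is arranged as the term [db] of [deviation], linear in [Gg], [Sg ^ 2] and [Sg * Cg]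
    with coefficients from the end point. *)
Lemma is_derive_slope_param k b s : den k b s <> 0 ->
  is_derive (fun k => slope k b s) k
    ((k + slope k b s ^ 2) * Gg k s + slope k b s * Sg k s ^ 2 + Sg k s * Cg k s).
Proof.
  intros Hd. unfold slope at 1. evar_last.
  - apply (is_derive_div (fun k => k * Sg k s + b * Cg k s) (fun k => den k b s));
      [|apply is_derive_den_param|exact Hd].
    apply (is_derive_plus (fun k => k * Sg k s) (fun k => b * Cg k s)).
    + apply (is_derive_mult (fun k => k) (fun k => Sg k s));
        [apply is_derive_id|apply is_derive_Sg_param|intros; apply Rmult_comm].
    + apply (is_derive_scal (fun k => Cg k s)), is_derive_Cg_param.
  - rewrite den_param_eq by exact Hd.
    unfold plus, scal, one; simpl; unfold mult; simpl.
    assert (E : Sg k s + k * Eg k s - b * s * Sg k s / 2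
      = k * den k b s * Gg k s + (k * Sg k s + b * Cg k s) * Sg k s ^ 2 / 2
        + Sg k s * Cg k s * den k b s).
    { unfold Gg, den. clear Hd. pose proof (Cg_Sg k s) as H2. pose proof (Eg_eq k s) as H1.
      generalize dependent (Cg k s); generalize dependent (Sg k s); generalize dependent (Eg k s).
      intros E S C H2 H1.
      assert (r1 : 2 * k * E - s * C + S = 0) by lra.
      assert (r2 : C ^ 2 + k * S ^ 2 - 1 = 0) by lra.
      apply Rminus_diag_uniq_sym.
      transitivity ((k * E + S - b * s * S / 2) * (C ^ 2 + k * S ^ 2 - 1)
        - (k * S ^ 2 / 2 + b * S * C / 2) * (2 * k * E - s * C + S)); [field|].
      rewrite r1, r2; ring. }
    transitivity (((Sg k s + k * Eg k s - b * s * Sg k s / 2) * den k b s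
      + (k * Sg k s + b * Cg k s) * (den k b s * (slope k b s * Gg k s + Sg k s ^ 2 / 2)))
      / den k b s ^ 2); [field; exact Hd|].
    rewrite E. unfold slope. field. exact Hd.
Qed.

(** * The differential of the quotient map *)

Definition fiber (x : J3) : R4 := let '(t, u, p, q, r) := x in (u, p, q, r).

Lemma jet_at_fiber x : jet_at (jt x) (fiber x) = x.
Proof. now destruct x as [[[[t u] p] q] r]. Qed.

Definition J3_NormedModule : NormedModule R_AbsRing :=
  prod_NormedModule _ (prod_NormedModule _ (prod_NormedModule _
    (prod_NormedModule _ R_NormedModule R_NormedModule) R_NormedModule) R_NormedModule)
    R_NormedModule.

Lemma is_linear_fiber : is_linear fiber.
Proof.
  apply (is_linear_ext (U := J3_NormedModule)
   (fun x : J3 => (snd (fst (fst (fst x))), snd (fst (fst x)), snd (fst x), snd x))).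
  - now intros [[[[t u] p] q] r].
  - repeat apply is_linear_prod;
    repeat first [apply is_linear_snd | apply is_linear_fst | eapply is_linear_comp].
Qed.

(** The variation of [(u, p, q, r)] under a variation [p f] of the solution, as a
    function of [(f, f', f'' / 2, (f''' + 4 k f') / 2)], where [q = 2 p b] and
    [r = p (2 k + 6 b^2)]. *)
Definition deviation (p b k : R) (v : R4) : R4 :=
  let '(g, s2, sc, o) := v in
  let dp := p * (2 * b * g + s2) in
  let db := (k + b ^ 2) * g + b * s2 + sc in
  (p * g, dp, 2 * (dp * b + p * db), dp * (2 * k + 6 * b ^ 2) + p * (2 * o + 12 * b * db)).

Definition ju (x : J3) : R := let '(t, u, p, q, r) := x in u.
Lemma J3_eta x : (jt x, ju x, jp x, jq x, jr x) = x.
Proof. now destruct x as [[[[t u] p] q] r]. Qed.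

Lemma ex_filterdiff_coord (i : J3 -> R) (x : J3) :
  In i [jt; ju; jp; jq; jr] -> ex_filterdiff i (locally x).
Proof.
  intros Hi. apply ex_filterdiff_linear.
  apply (is_linear_ext (U := J3_NormedModule) (V := R_NormedModule)
    (fun x => i (fst (fst (fst (fst x))), snd (fst (fst (fst x))), snd (fst (fst x)),
       snd (fst x), snd x))).
  { now intros [[[[t u] p] q] r]. }
  simpl in Hi. decompose [or] Hi; try contradiction; subst i; simpl;
  repeat first [apply is_linear_snd | apply is_linear_fst | eapply is_linear_comp].
Qed.

(** Shows that the chart at [t0] is available on a neighbourhood of [x]. Rescaling time to [w] in
    [[0, 1]] turns the variable segment from 0 to [t0 - jt x'] into a fixed compact one, to which
    [tube] applies. *)
Lemma reaches_locally x t0 : jp x <> 0 -> reaches x (t0 - jt x) ->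
  locally x (fun x' => jp x' <> 0 /\ reaches x' (t0 - jt x')).
Proof.
  intros Hp Hr. apply filter_and.
  - assert (C : continuous jp x).
    { apply (filterdiff_continuous (U := J3_NormedModule) (V := R_NormedModule) jp x).
      apply ex_filterdiff_coord. simpl; auto. }
    apply (C _ (open_neq 0 (jp x) Hp)).
  - apply (tube (fun z => xden (fst z) (snd z * (t0 - jt (fst z))))).
    intros w Hw. split; [|now apply Hr].
    apply (filterdiff_continuous (U := prod_NormedModule R_AbsRing J3_NormedModule R_NormedModule)
      (V := R_NormedModule)).
    assert (H : forall i : J3 -> R, In i [jt; ju; jp; jq; jr] ->
      ex_filterdiff (fun z : J3 * R => i (fst z)) (locally (x, w))).
    { intros i Hi.
      apply (ex_filterdiff_comp' (U := prod_NormedModule R_AbsRing J3_NormedModule R_NormedModule)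
        (V := J3_NormedModule) fst i).
      - apply ex_filterdiff_linear, is_linear_fst.
      - now apply ex_filterdiff_coord. }
    apply (ex_filterdiff_ext_locally
      (U := prod_NormedModule R_AbsRing J3_NormedModule R_NormedModule) (V := R_NormedModule)
      (fun z : J3 * R => xden (jt (fst z), ju (fst z), jp (fst z), jq (fst z), jr (fst z))
        (snd z * (t0 - jt (fst z))))).
    { apply filter_forall. now intros [[[[[t u] p] q] r] y]. }
    assert (Ht : ex_filterdiff (fun z : J3 * R => snd z * (t0 - jt (fst z))) (locally (x, w))).
    { apply (ex_fd_mult (V := prod_NormedModule R_AbsRing J3_NormedModule R_NormedModule)
        (x, w) snd (fun z => t0 - jt (fst z)));
        [apply ex_filterdiff_linear, is_linear_snd|].
      apply (ex_fd_minus (V := prod_NormedModule R_AbsRing J3_NormedModule R_NormedModule)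
        (x, w) (fun _ => t0) (fun z => jt (fst z)));
        [apply ex_fd_const|apply H; simpl; auto]. }
    simpl in H.
    apply (ex_fd_xden (V := prod_NormedModule R_AbsRing J3_NormedModule R_NormedModule)
      (x, w) (fun z => jt (fst z)) (fun z => ju (fst z)) (fun z => jp (fst z))
      (fun z => jq (fst z)) (fun z => jr (fst z)) (fun z => snd z * (t0 - jt (fst z))));
      first [exact Ht | exact Hp | apply H; auto 10].
Qed.

Lemma ex_filterdiff_flow_to x t0 : jp x <> 0 -> xden x (t0 - jt x) <> 0 ->
  ex_filterdiff (fun x' => fiber (flow x' (t0 - jt x'))) (locally x).
Proof.
  intros Hp Hd.
  apply (ex_filterdiff_comp' (V := J3_NormedModule) (fun x' => flow x' (t0 - jt x')) fiber);
    [|apply ex_filterdiff_linear, is_linear_fiber].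
  apply (ex_filterdiff_ext_locally (U := J3_NormedModule) (V := J3_NormedModule)
    (fun z : J3 => flow (jt z, ju z, jp z, jq z, jr z) (t0 - jt z))).
  { apply filter_forall. now intros [[[[t u] p] q] r]. }
  apply (ex_filterdiff_flow (V := J3_NormedModule) x jt ju jp jq jr (fun z => t0 - jt z));
    try (apply ex_filterdiff_coord; simpl; now auto 10); rewrite ?J3_eta; auto.
  apply (ex_fd_minus (V := J3_NormedModule) x (fun _ => t0) jt);
    [apply ex_fd_const|apply ex_filterdiff_coord; simpl; auto].
Qed.

(** Varying [r] alone fixes [beta] and moves [kap] at rate [/ (2 * p)], so the derivative is that
    multiple of the derivative in [k]. *)
Lemma is_derive_flow_r t u p q r s :
  let x := (t, u, p, q, r) : J3 in let z := flow x s in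
  p <> 0 -> xden x s <> 0 ->
  is_derive (fun h => fiber (flow (t, u, p, q, h) s)) r
    (scal (/ (2 * p)) (deviation (jp z) (beta z) (kap x)
       (Gg (kap x) s, Sg (kap x) s ^ 2, Sg (kap x) s * Cg (kap x) s, 1))).
Proof.
  intros x z Hp Hd.
  assert (Ez : beta z = slope (kap x) (beta x) s) by now apply beta_flow.
  rewrite Ez. unfold z. rewrite jp_flow.
  set (b := beta x) in *. set (k := kap x) in *. clear Ez z.
  change (xden x s) with (den k b s) in *. simpl jp.
  apply (is_derive_ext (fun h =>
    let k := kap (t, u, p, q, h) in
    (u + p * (Sg k s / den k b s), p * / den k b s ^ 2, 2 * (p * / den k b s ^ 2) * slope k b s,
     p * / den k b s ^ 2 * (2 * k + 6 * slope k b s ^ 2)))).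
  { reflexivity. }
  assert (Hk : is_derive (fun h => kap (t, u, p, q, h)) r (/ (2 * p))).
  { unfold kap, Schwarzian. auto_derive; [exact I|field; exact Hp]. }
  apply (is_derive_comp (fun k => (u + p * (Sg k s / den k b s), p * / den k b s ^ 2,
     2 * (p * / den k b s ^ 2) * slope k b s,
     p * / den k b s ^ 2 * (2 * k + 6 * slope k b s ^ 2))) (fun h => kap (t, u, p, q, h)));
  [|exact Hk].
  change (kap (t, u, p, q, r)) with k.
  assert (Hp1 : is_derive (fun k => p * / den k b s ^ 2) k
      (p / den k b s ^ 2 * (2 * slope k b s * Gg k s + Sg k s ^ 2))).
  { evar_last.
    - apply (is_derive_scal (fun k => / den k b s ^ 2)), is_derive_inv_den_sqr_param, Hd.
    - unfold scal; simpl; unfold mult; simpl. field. exact Hd. }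
  pose proof (is_derive_slope_param k b s Hd) as Hs.
  repeat apply is_derive_pair.
  - evar_last.
    + apply (is_derive_plus (fun _ => u) (fun k => p * (Sg k s / den k b s)));
        [apply is_derive_const|].
      apply (is_derive_scal (fun k => Sg k s / den k b s)), is_derive_Sg_den_param, Hd.
    + unfold plus, scal, zero; simpl; unfold mult; simpl. field. exact Hd.
  - exact Hp1.
  - evar_last.
    + apply (is_derive_mult (fun k => 2 * (p * / den k b s ^ 2)) (fun k => slope k b s));
        [|exact Hs|intros; apply Rmult_comm].
      apply (is_derive_scal (fun k => p * / den k b s ^ 2)), Hp1.
    + unfold plus, scal; simpl; unfold mult; simpl. field. exact Hd.
  - evar_last.
    + apply (is_derive_mult (fun k => p * / den k b s ^ 2) (fun k => 2 * k + 6 * slope k b s ^ 2));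
        [exact Hp1| |intros; apply Rmult_comm].
      apply (is_derive_plus (fun k => 2 * k) (fun k => 6 * slope k b s ^ 2)).
      * apply (is_derive_scal (fun k => k)), is_derive_id.
      * apply (is_derive_scal (fun k => slope k b s ^ 2)),
          (is_derive_pow (fun k => slope k b s) 2), Hs.
    + unfold plus, scal, one; simpl; unfold mult; simpl. field. exact Hd.
Qed.

Definition R4_NormedModule : NormedModule R_AbsRing :=
  prod_NormedModule _ (prod_NormedModule _ (prod_NormedModule _ R_NormedModule R_NormedModule)
    R_NormedModule) R_NormedModule.

Lemma is_derive_unique_R4 (f : R -> R4) (x : R) (l1 l2 : R4) :
  is_derive f x l1 -> is_derive f x l2 -> l1 = l2.
Proof.
  assert (Huniq : forall (g : R -> R) a b, is_derive g x a -> is_derive g x b -> a = b).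
  { intros g a b Ha Hb. now rewrite <- (is_derive_unique g x a Ha), <- (is_derive_unique g x b Hb). }
  destruct l1 as [[[a1 a2] a3] a4], l2 as [[[b1 b2] b3] b4]. intros H1 H2.
  pose proof (is_derive_fst _ _ _ H1) as H1'. pose proof (is_derive_fst _ _ _ H2) as H2'.
  pose proof (is_derive_fst _ _ _ H1') as H1''. pose proof (is_derive_fst _ _ _ H2') as H2''.
  repeat f_equal.
  - exact (Huniq _ _ _ (is_derive_fst _ _ _ H1'') (is_derive_fst _ _ _ H2'')).
  - exact (Huniq _ _ _ (is_derive_snd _ _ _ H1'') (is_derive_snd _ _ _ H2'')).
  - exact (Huniq _ _ _ (is_derive_snd _ _ _ H1') (is_derive_snd _ _ _ H2')).
  - exact (Huniq _ _ _ (is_derive_snd _ _ _ H1) (is_derive_snd _ _ _ H2)).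
Qed.

(** The flow to time [t0] represents the quotient map in the chart. Its differential on [partial_r]
    is identified by differentiating along a line in the [r] direction, on which the elapsed time is
    constant. *)
Lemma pushforward_partial_r x t0 : jp x <> 0 -> reaches x (t0 - jt x) ->
  let s := t0 - jt x in let k := kap x in let z := flow x s in
  exists L, is_pushforward F_eq t0 x L /\
    L partial_r = scal (/ (2 * jp x)) (deviation (jp z) (beta z) k
      (Gg k s, Sg k s ^ 2, Sg k s * Cg k s, 1)).
Proof.
  intros Hp Hr s k z.
  assert (Hd : xden x s <> 0) by (rewrite <- (Rmult_1_l s); apply Hr; lra).
  destruct (ex_filterdiff_flow_to x t0 Hp Hd) as [L HL].
  exists L. split.
  - eexists; split; [|exact HL].
    generalize (reaches_locally x t0 Hp Hr). apply filter_imp. intros y [Hyp Hyr].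
    set (w := flow y (t0 - jt y)).
    replace t0 with (jt w) by (unfold w; rewrite jt_flow; ring).
    rewrite jet_at_fiber. unfold w. rewrite <- (flow_0 y Hyp) at 1.
    apply pi_flow; auto. apply reaches_0.
  - destruct x as [[[[t u] p] q] r].
    apply (is_derive_unique_R4 (fun h => fiber (flow (t, u, p, q, h) s)) r).
    + assert (Hpath : is_derive (V := J3_NormedModule) (fun h => (t, u, p, q, h)) r partial_r).
      { repeat apply is_derive_pair;
          [apply (is_derive_const (V := R_NormedModule)) ..|apply (is_derive_id (K := R_AbsRing))]. }
      unfold is_derive.
      apply (filterdiff_ext_lin _ (fun y : R => L (scal y (partial_r : J3_NormedModule)))).
      * apply (filterdiff_comp' (V := J3_NormedModule) (fun h => (t, u, p, q, h))
          (fun x' => fiber (flow x' (t0 - jt x')))); [exact Hpath|exact HL].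
      * intros y. destruct HL as [HL _]. apply (linear_scal L HL).
    + now apply is_derive_flow_r.
Qed.

(** * Linear isomorphisms of [R4] *)

Lemma plus_R4 (a b c d a' b' c' d' : R) :
  plus ((a, b, c, d) : R4_NormedModule) (a', b', c', d') = (a + a', b + b', c + c', d + d').
Proof. reflexivity. Qed.

Lemma scal_R4 (k a b c d : R) :
  scal k ((a, b, c, d) : R4_NormedModule) = (k * a, k * b, k * c, k * d).
Proof. reflexivity. Qed.

Lemma R4_eq (a b c d a' b' c' d' : R) :
  a = a' -> b = b' -> c = c' -> d = d' -> (a, b, c, d) = (a', b', c', d').
Proof. now intros -> -> -> ->. Qed.

(** The predicate [is_linear] includes a norm bound. In finite dimension it is automatic: [f] is a
    sum of coordinates times the images of the basis vectors. *)
Lemma is_linear_R4 {W : NormedModule R_AbsRing} (f : R4 -> W) :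
  (forall v w : R4_NormedModule, f (plus v w) = plus (f v) (f w)) ->
  (forall (k : R) (v : R4_NormedModule), f (scal k v) = scal k (f v)) ->
  is_linear f.
Proof.
  intros Hadd Hscal.
  assert (Hcoord : forall (c : R4 -> R) (e : W), is_linear c ->
    is_linear (fun v : R4 => scal (c v) e)).
  { intros c e Hc. apply (is_linear_comp c (fun x : R => scal x e) Hc).
    apply (is_linear_scal_l (K := R_AbsRing) e). }
  assert (Hplus : forall g h : R4 -> W, is_linear g -> is_linear h ->
    is_linear (fun v => plus (g v) (h v))).
  { intros g h Hg Hh. apply (is_linear_comp (fun v : R4 => (g v, h v))
      (fun p : W * W => plus (fst p) (snd p))); [now apply is_linear_prod|apply is_linear_plus]. }
  apply (is_linear_ext (U := R4_NormedModule) (fun v : R4 =>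
    plus (plus (plus (scal (fst (fst (fst v))) (f (1, 0, 0, 0)))
      (scal (snd (fst (fst v))) (f (0, 1, 0, 0))))
      (scal (snd (fst v)) (f (0, 0, 1, 0)))) (scal (snd v) (f (0, 0, 0, 1))))).
  - intros [[[a b] c] d]; simpl. rewrite <- !Hscal, <- !Hadd, !scal_R4, !plus_R4.
    f_equal; apply R4_eq; ring.
  - repeat apply Hplus; apply Hcoord;
    repeat first [apply is_linear_snd | apply is_linear_fst | eapply is_linear_comp].
Qed.

Lemma linear_iso_intro (A B : R4 -> R4) :
  (forall v w : R4_NormedModule, A (plus v w) = plus (A v) (A w)) ->
  (forall (k : R) (v : R4_NormedModule), A (scal k v) = scal k (A v)) ->
  (forall v, B (A v) = v) -> (forall v, A (B v) = v) -> linear_iso A.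
Proof. intros. split; [now apply (is_linear_R4 (W := R4_NormedModule))|now exists B]. Qed.

Lemma linear_iso_comp (A B : R4 -> R4) :
  linear_iso A -> linear_iso B -> linear_iso (fun v => B (A v)).
Proof.
  intros [HA [A' [HA1 HA2]]] [HB [B' [HB1 HB2]]]. split.
  - now apply (is_linear_comp A B).
  - exists (fun v => A' (B' v)). split; intros v; [now rewrite HB1|now rewrite HA2].
Qed.

Ltac prove_linear_iso B :=
  apply (linear_iso_intro _ B);
  [intros [[[? ?] ?] ?] [[[? ?] ?] ?]; cbv beta iota zeta; rewrite !plus_R4; cbv beta iota zeta;
   unfold Rdiv; apply R4_eq; ring
  |intros ? [[[? ?] ?] ?]; cbv beta iota zeta; rewrite !scal_R4; cbv beta iota zeta;
   unfold Rdiv; apply R4_eq; ring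
  |intros [[[? ?] ?] ?]; simpl; apply R4_eq; field; auto
  |intros [[[? ?] ?] ?]; simpl; apply R4_eq; field; auto].

(** Forward substitution: [deviation p b k] is triangular with diagonal [p, p, 2 p, 2 p]. *)
Definition deviation_inv (p b k : R) (v : R4) : R4 :=
  let '(u1, p1, q1, r1) := v in
  let g := u1 / p in let s2 := p1 / p - 2 * b * g in
  let db := q1 / (2 * p) - p1 / p * b in
  (g, s2, db - (k + b ^ 2) * g - b * s2,
   (r1 / p - p1 / p * (2 * k + 6 * b ^ 2) - 12 * b * db) / 2).

Lemma linear_iso_deviation_inv p b k : p <> 0 -> linear_iso (deviation_inv p b k).
Proof.
  intros Hp. unfold deviation_inv. prove_linear_iso (deviation p b k).
Qed.

Lemma deviation_invK p b k v : p <> 0 -> deviation_inv p b k (deviation p b k v) = v.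
Proof.
  intros Hp. destruct v as [[[g s2] sc] o]. simpl. apply R4_eq; field; auto.
Qed.

Lemma reparametrization_affine (D : R -> Prop) (c t0 : R) : c <> 0 ->
  reparametrization D (fun t => c * (t0 - t)).
Proof.
  intros Hc t _.
  assert (Hd : forall z, is_derive (fun t => c * (t0 - t)) z (- c))
    by (intros z; auto_derive; [exact I|ring]).
  split.
  - assert (HD : forall n z, Derive_n (fun t => c * (t0 - t)) (S n) z = Derive_n (fun _ => - c) n z).
    { induction n as [|n IH]; intros z; [now apply is_derive_unique|].
      now apply Derive_ext. }
    intros [|[|n]]; [exact I|eexists; apply Hd|].
    apply (ex_derive_ext (Derive_n (fun _ => - c) n)); [now intros z; rewrite HD|].
    exact (ex_derive_n_const (- c) (S n) t).
  - replace (Derive (fun t => c * (t0 - t)) t) with (- c); [lra|].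
    symmetry. apply is_derive_unique, Hd.
Qed.

(** Reduces each case to an identity between curves in [R4]. Up to the scalar [/ (2 * jp X)], the
    pushforward from time [t] is [deviation] at the fixed jet [z] over [t0], applied to a curve that
    depends on [kap] and [t0 - t] only; undoing [deviation] leaves the map [M] to the model. *)
Lemma canonical_curve_equivalent_intro (s : J3 -> Prop) (x : J3) (c : R -> R4)
    (w : R) (M : R4 -> R4) :
  solution_space F_eq s -> s x -> w <> 0 -> linear_iso M -> (forall t, c t <> zero) ->
  (forall tau, M (Gg (kap x) tau, Sg (kap x) tau ^ 2, Sg (kap x) tau * Cg (kap x) tau, 1)
     = c (w * tau)) ->
  canonical_curve_equivalent F_eq s c.
Proof.
  intros [x0 [Hx0 ->]] Hx Hw HM Hc HMc t0 [y0 Hy0].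
  apply pi_inv in Hx as [_ [sx [Hrx [Hdx ->]]]].
  apply pi_inv in Hy0 as [_ [s0 [Hr0 [Hd0 E0]]]].
  rewrite (kap_flow x0 sx Hx0 Hdx) in HMc.
  set (z := flow x0 s0) in *.
  assert (Hz : jp z <> 0) by now apply jp_flow_neq_0.
  assert (Tz : jt z = t0) by (rewrite <- E0; now destruct y0 as [[[? ?] ?] ?]).
  exists (fun v => M (deviation_inv (jp z) (beta z) (kap x0) v)), (fun t => w * (t0 - t)).
  split; [|split].
  - apply (linear_iso_comp (deviation_inv (jp z) (beta z) (kap x0)) M);
      [now apply linear_iso_deviation_inv|exact HM].
  - now apply reparametrization_affine.
  - intros t y Hy. apply pi_inv in Hy as [_ [s1 [Hr1 [Hd1 E1]]]].
    set (X := jet_at t y) in *.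
    assert (HX : jp X <> 0) by (rewrite E1; now apply jp_flow_neq_0).
    assert (TX : jt X = t) by (unfold X; now destruct y as [[[? ?] ?] ?]).
    assert (KX : kap X = kap x0) by (rewrite E1; now apply kap_flow).
    (* [X] and [z] are both reached from [x0], hence joined to each other; their times then
       determine the flow parameter. *)
    assert (Hpi : pi F_eq X z) by (rewrite E1; now apply pi_flow).
    apply pi_inv in Hpi as [_ [s [Hrs [_ Ez]]]].
    assert (Es : s = t0 - jt X).
    { rewrite <- Tz, Ez, jt_flow. ring. }
    rewrite Es in Hrs, Ez.
    destruct (pushforward_partial_r X t0 HX Hrs) as [L [HL EL]].
    exists L. split; [exact HL|]. rewrite EL. rewrite <- Ez, KX.
    destruct (linear_iso_deviation_inv (jp z) (beta z) (kap x0) Hz) as [HA _].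
    destruct HM as [HM _].
    rewrite (linear_scal _ HA), (linear_scal _ HM), deviation_invK, HMc, TX by exact Hz.
    assert (Hn : / (2 * jp X) <> 0) by (apply Rinv_neq_0_compat; lra).
    split; [|split; [apply Hc|now exists (/ (2 * jp X))]].
    intros E. apply (Hc (w * (t0 - t))).
    set (v := c (w * (t0 - t)) : R4_NormedModule) in *.
    set (m := / (2 * jp X)) in *.
    transitivity (scal (/ m) (scal m v)).
    + rewrite (scal_assoc (V := R4_NormedModule)).
      change (mult (/ m) m) with (/ m * m). rewrite Rinv_l by exact Hn.
      symmetry. apply (scal_one (V := R4_NormedModule)).
    + transitivity (scal (/ m) (zero : R4_NormedModule)); [now f_equal|].
      apply (scal_zero_r (V := R4_NormedModule)).
Qed.

(** * The three model curves *)

Lemma model_neg w tau :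
  let k := - w ^ 2 in let th := 2 * w * tau in
  1 + 2 * w ^ 2 * Sg k tau ^ 2 + 2 * w * (Sg k tau * Cg k tau) = exp th /\
  1 + 2 * w ^ 2 * Sg k tau ^ 2 - 2 * w * (Sg k tau * Cg k tau) = exp (- th) /\
  2 * w * (Sg k tau * Cg k tau) - 4 * w ^ 3 * Gg k tau = th.
Proof.
  intros k th.
  pose proof (Cg_Sg k tau) as H. pose proof (Gg_eq k tau) as HG.
  pose proof (Cg_Sg_neg w tau) as Hp. pose proof (Cg_Sg_neg (- w) tau) as Hm.
  replace (- (- w) ^ 2) with k in Hm by (unfold k; ring). fold k in Hp.
  unfold th. repeat split.
  (* [exp th] is the square of [Cg + w Sg], and [Cg ^ 2] is eliminated by the conserved quadratic
     form; the next case is the same with [- w]. *)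
  - replace (2 * w * tau) with (w * tau + w * tau) by ring.
    rewrite exp_plus, <- Hp, <- H. unfold k. ring.
  - replace (- (2 * w * tau)) with (- w * tau + - w * tau) by ring.
    rewrite exp_plus, <- Hm, <- H. unfold k. ring.
  - transitivity (2 * w * (2 * k * Gg k tau + Sg k tau * Cg k tau)); [unfold k; ring|].
    rewrite HG. ring.
Qed.

Lemma model_pos w tau :
  let k := w ^ 2 in let th := 2 * w * tau in
  2 * w * (Sg k tau * Cg k tau) = sin th /\
  1 - 2 * w ^ 2 * Sg k tau ^ 2 = cos th /\
  4 * w ^ 3 * Gg k tau = th - sin th.
Proof.
  intros k th.
  assert (H1 : 2 * w * (Sg k tau * Cg k tau) = sin th).
  { unfold th. rewrite (Rmult_assoc 2 w tau), sin_2a, <- Sg_pos, <- Cg_pos. unfold k. ring. }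
  split; [exact H1|split].
  - unfold th. rewrite (Rmult_assoc 2 w tau), cos_2a_sin, <- Sg_pos. unfold k. ring.
  - rewrite <- H1. pose proof (Gg_eq k tau) as HG.
    transitivity (2 * w * (2 * k * Gg k tau)); [unfold k; ring|].
    rewrite HG. unfold th. ring.
Qed.

Lemma model_0 tau : Sg 0 tau = tau /\ Cg 0 tau = 1 /\ 3 * Gg 0 tau = tau ^ 3.
Proof.
  unfold Gg, Sg, Cg, Eg. rewrite Rmult_0_l, sn_0, cs_0, dsn_0.
  repeat split; field.
Qed.

Theorem theorem2p4 :
  (forall x : J3, jp x <> 0 ->
     W1 F_eq x = 0 /\ W0 F_eq x = - (36/100) * Schwarzian x ^ 2) /\
  (forall (s : J3 -> Prop) (x : J3), solution_space F_eq s -> s x ->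
     (Schwarzian x < 0 ->
        canonical_curve_equivalent F_eq s
          (fun t => affine_chart (exp (- t), t, - exp t))) /\
     (Schwarzian x > 0 ->
        canonical_curve_equivalent F_eq s
          (fun t => affine_chart (t - sin t, cos t, t + sin t))) /\
     (Schwarzian x = 0 ->
        canonical_curve_equivalent F_eq s rational_normal_curve)).
Proof.
  split; [exact wuenschmann_F_eq|].
  intros s x Hs Hx. repeat split; intros HS.
  (* Hyperbolic case. The speed [2 * w] comes from the double angle [th = 2 w tau]; the rows of the
     matrix are the combinations in [model_neg] giving [1, exp (- th), th, - exp th]. *)
  - set (w := sqrt (- kap x)).
    assert (Hk : kap x = - w ^ 2).
    { unfold w. rewrite pow2_sqrt by (unfold kap; lra). ring. }
    assert (Hw : w <> 0) by (intros E; unfold kap in Hk; rewrite E in Hk; lra).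
    apply (canonical_curve_equivalent_intro s x _ (2 * w) (fun v : R4 =>
      let '(g, s2, sc, o) := v in
      (o, o + 2 * w ^ 2 * s2 - 2 * w * sc, 2 * w * sc - 4 * w ^ 3 * g,
       - (o + 2 * w ^ 2 * s2 + 2 * w * sc)))); auto.
    + prove_linear_iso (fun v : R4 => let '(a, b, c, d) := v in
       ((- (b + d) / 2 - c) / (4 * w ^ 3), (b - d - 2 * a) / (4 * w ^ 2), - (b + d) / (4 * w), a)).
    + intros t E. apply (f_equal (fun v : R4 => fst (fst (fst v)))) in E.
      revert E. apply R1_neq_R0.
    + intros tau. rewrite Hk. destruct (model_neg w tau) as [-> [-> ->]]. reflexivity.
  - set (w := sqrt (kap x)).
    assert (Hk : kap x = w ^ 2).
    { unfold w. rewrite pow2_sqrt by (unfold kap; lra). ring. }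
    assert (Hw : w <> 0) by (intros E; unfold kap in Hk; rewrite E in Hk; lra).
    (* The last coordinate is [th + sin th], written as [(th - sin th) + 2 sin th]. *)
    apply (canonical_curve_equivalent_intro s x _ (2 * w) (fun v : R4 =>
      let '(g, s2, sc, o) := v in
      (o, 4 * w ^ 3 * g, o - 2 * w ^ 2 * s2, 4 * w ^ 3 * g + 2 * (2 * w * sc)))); auto.
    + prove_linear_iso (fun v : R4 => let '(a, b, c, d) := v in
       (b / (4 * w ^ 3), (a - c) / (2 * w ^ 2), (d - b) / (4 * w), a)).
    + intros t E. apply (f_equal (fun v : R4 => fst (fst (fst v)))) in E.
      revert E. apply R1_neq_R0.
    + intros tau. rewrite Hk. destruct (model_pos w tau) as [-> [-> ->]].
      unfold affine_chart. f_equal. ring.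
  - assert (Hk : kap x = 0) by (unfold kap; lra).
    (* At [k = 0] the entries [o, sc, s2, 3 g] are the powers of [tau] from degree 0 to 3. *)
    apply (canonical_curve_equivalent_intro s x _ 1 (fun v : R4 =>
      let '(g, s2, sc, o) := v in (o, sc, s2, 3 * g))); auto.
    + prove_linear_iso (fun v : R4 => let '(a, b, c, d) := v in (d / 3, c, b, a)).
    + intros t E. apply (f_equal (fun v : R4 => fst (fst (fst v)))) in E.
      revert E. apply R1_neq_R0.
    + intros tau. rewrite Hk, Rmult_1_l. destruct (model_0 tau) as [-> [-> ->]].
      unfold rational_normal_curve. now rewrite Rmult_1_r.
Qed.
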